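(* In the edge-distinguishing game (EDGe) played on the path $P_6$ (with $\lambda(P_6)$ colors), Player 1 has a winning strategy.
   Context: $P_n$ is the path on $n$ vertices. For a positive integer $k$ let $[k]=\{1,\dots,k\}$. A $k$-coloring $c:V(G)\to[k]$ induces $c'(\{u,v\})=\{c(u),c(v)\}$ (a multiset); $c$ is edge-distinguishing if $c'$ is injective, and $\lambda(G)$ is the least $k$ admitting such a coloring. A partial coloring on $U\subseteq V(G)$ has partial induced edge coloring on $G[U]$. EDGe on $G$: two players, Player 1 first, alternately color an uncolored vertex with a color from $[\lambda(G)]$; a move is legal iff afterwards the partial induced edge coloring of the colored vertices is injective. The player making the last legal move wins. A winning strategy guarantees a win regardless of the opponent's play. *)

(* Defs.v *)
From HB Require Import structures.
From mathcomp Require Import all_boot.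

Set Implicit Arguments.
Unset Strict Implicit.
Unset Printing Implicit Defensive.

Record sgraph := SGraph {
  vertex :> finType;
  adj : rel vertex;
  adj_sym : symmetric adj;
  adj_irr : irreflexive adj
}.

Definition edges (G : sgraph) : {set {set G}} :=
  [set [set p.1; p.2] | p : G * G & adj p.1 p.2].

(* Edges of the induced subgraph G[U]. *)
Definition edges_in (G : sgraph) (U : {set G}) : {set {set G}} :=
  [set e in edges G | e \subset U].

(* The multiset of colors on the ends of an edge e, as a multiplicity
   function. *)
Definition induced (G : sgraph) (C : finType) (c : G -> C) (e : {set G}) :
  {ffun C -> nat} := [ffun a => #|[set v in e | c v == a]|].

Definition edge_distinguishing (G : sgraph) (k : nat) (c : {ffun G -> 'I_k}) :
  bool := dinjectiveb (induced c) (mem (edges G)).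

Definition ed_colorable (G : sgraph) (k : nat) : bool :=
  [exists c : {ffun G -> 'I_k}, edge_distinguishing c].

Lemma ex_ed_colorable (G : sgraph) : exists k, ed_colorable G k.
Proof.
exists #|G|; apply/existsP; exists [ffun v => enum_rank v].
apply/dinjectiveP => e1 e2 _ _ eq12; apply/setP => v.
have E (e : {set G}) :
    (v \in e) = (0 < induced [ffun w => enum_rank w] e (enum_rank v)).
  rewrite ffunE; apply/idP/card_gt0P => [ve | [w]].
    by exists v; rewrite inE ve ffunE eqxx.
  by rewrite inE ffunE => /andP[we /eqP/enum_rank_inj <-].
by rewrite !E eq12.
Qed.

Definition lambda (G : sgraph) : nat := ex_minn (ex_ed_colorable G).

(* The set U of colored vertices of a partial coloring f is where f is not
   None. *)
Definition pcoloring (G : sgraph) (k : nat) := {ffun G -> option 'I_k}.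

Definition colored (G : sgraph) (k : nat) (f : pcoloring G k) : {set G} :=
  [set v | f v != None].

(* On edges of G[U] the color None has multiplicity 0, so that induced f is
   the partial induced edge coloring. *)
Definition partial_edge_distinguishing (G : sgraph) (k : nat)
  (f : pcoloring G k) : bool :=
  dinjectiveb (induced f) (mem (edges_in (colored f))).

Definition move (G : sgraph) : Type := (G * 'I_(lambda G))%type.

Definition position (G : sgraph) := pcoloring G (lambda G).

Definition start (G : sgraph) : position G := [ffun _ => None].

Definition do_move (G : sgraph) (f : position G) (m : move G) : position G :=
  [ffun v => if v == m.1 then Some m.2 else f v].

Definition legal (G : sgraph) (f : position G) (m : move G) : bool :=
  (f m.1 == None) && partial_edge_distinguishing (do_move f m).

(* A history is the sequence of moves made so far, oldest first. Player 1 makes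
   the moves of even index, so Player 1 is to move iff its size is even, and
   made the last move iff its size is odd. *)
Definition history (G : sgraph) : Type := seq (move G).

Definition position_after (G : sgraph) (h : history G) : position G :=
  foldl (@do_move G) (start G) h.

Definition legal_history (G : sgraph) (h : history G) : Prop :=
  forall (h1 h2 : history G) (m : move G),
    h = h1 ++ m :: h2 -> legal (position_after h1) m.

Definition game_over (G : sgraph) (h : history G) : Prop :=
  forall m : move G, ~~ legal (position_after h) m.

Definition strategy (G : sgraph) : Type := history G -> move G.

Definition follows1 (G : sgraph) (s : strategy G) (h : history G) : Prop :=
  forall (h1 h2 : history G) (m : move G),
    h = h1 ++ m :: h2 -> ~~ odd (size h1) -> m = s h1.

(* The first clause makes s play legally whenever Player 1 can move; since
   every play is finite, the second one then says that Player 1 makes the last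
   legal move in every play in which Player 1 follows s. *)
Definition winning1 (G : sgraph) (s : strategy G) : Prop :=
  forall h : history G, legal_history h -> follows1 s h ->
    (~~ odd (size h) -> ~ game_over h -> legal (position_after h) (s h)) /\
    (game_over h -> odd (size h)).

Definition player1_has_winning_strategy (G : sgraph) : Prop :=
  exists s : strategy G, winning1 s.

Definition path_adj (n : nat) : rel 'I_n :=
  [rel i j : 'I_n | (i.+1 == j :> nat) || (j.+1 == i :> nat)].

Lemma path_adj_sym n : symmetric (@path_adj n).
Proof. by move=> i j; rewrite /path_adj /= orbC. Qed.

Lemma path_adj_irr n : irreflexive (@path_adj n).
Proof. by move=> i; rewrite /path_adj /= orbb gtn_eqF. Qed.

Definition path_graph (n : nat) : sgraph :=
  SGraph (@path_adj_sym n) (@path_adj_irr n).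

(* Main.v *)
Require Import Defs.
From mathcomp Require Import all_boot.

(** A coloring with [k] colors gives every edge one of ['C(k.+1, 2)] multisets,
    so the five edges of P6 need three colors, which suffice. A position is
    winning for the player to move iff some legal move makes it losing for the
    opponent, and always making such a move is a winning strategy. Player 1
    wins by opening on the second vertex, as a finite search shows. *)

Set Implicit Arguments.
Unset Strict Implicit.
Unset Printing Implicit Defensive.

Lemma perm_eq_set2 (T : finType) (a b a' b' : T) :
  [set a; b] = [set a'; b'] -> perm_eq [:: a; b] [:: a'; b'].
Proof.
move=> eq_set.
have: b' \in [set a; b] by rewrite eq_set set22.
have: a' \in [set a; b] by rewrite eq_set set21.
have: b \in [set a'; b'] by rewrite -eq_set set22.
have: a \in [set a'; b'] by rewrite -eq_set set21.
rewrite !inE; do 4![case/orP=> /eqP ?]; subst=> //;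
  by rewrite (perm_catC [:: _] [:: _]).
Qed.

Lemma perm_eq_sort_map (T1 T2 : eqType) (leT : rel T2) (code : T1 -> T2) s t :
  total leT -> transitive leT -> antisymmetric leT -> injective code ->
  perm_eq s t = (sort leT (map code s) == sort leT (map code t)).
Proof.
move=> leT_total leT_tr leT_anti code_inj.
apply/idP/eqP => [/(perm_map code)|] /(perm_sortP leT_total leT_tr leT_anti) //.
exact: perm_map_inj.
Qed.

Lemma eq_uniq_map (T : Type) (T1 T2 : eqType) (f1 : T -> T1) (f2 : T -> T2) s :
  (forall x y, (f1 x == f1 y) = (f2 x == f2 y)) ->
  uniq (map f1 s) = uniq (map f2 s).
Proof.
move=> eq_f; elim: s => //= x s ->; rewrite -!has_pred1 !has_map.
by congr (~~ _ && _); apply: eq_has => y; apply: eq_f.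
Qed.

Lemma forall_prefix_rcons (T : Type) (P : seq T -> T -> Prop) s x :
  (forall s1 s2 y, rcons s x = s1 ++ y :: s2 -> P s1 y) ->
  (forall s1 s2 y, s = s1 ++ y :: s2 -> P s1 y) /\ P s x.
Proof.
move=> P_prefix; split; last by apply: (P_prefix s [::]); rewrite cats1.
move=> s1 s2 y eq_s; apply: (P_prefix s1 (rcons s2 x)).
by rewrite eq_s rcons_cat.
Qed.

(** * Winning positions *)

Section NormalPlay.

Variables (T : eqType) (options : T -> seq T).

(* Whether the player to move makes the last move, when play is cut off after
   [n] moves. *)
Fixpoint wins_within (n : nat) (x : T) : bool :=
  if n is n'.+1 then has (fun y => ~~ wins_within n' y) (options x) else false.

Variable rank : T -> nat.

Definition winning (x : T) : bool := wins_within (rank x) x.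

Lemma winningE x :
  (forall y, y \in options x -> (rank y).+1 = rank x) ->
  winning x = has (predC winning) (options x).
Proof.
rewrite /winning => rank_options.
case rank_x: (rank x) rank_options => [|n] rank_options /=.
  by apply/esym/hasP => -[y /rank_options].
by apply: eq_in_has => y /rank_options[rank_y]; rewrite /winning /= rank_y.
Qed.

End NormalPlay.

Lemma wins_within_morph (T1 T2 : eqType) (options1 : T1 -> seq T1)
    (options2 : T2 -> seq T2) (h : T1 -> T2) :
  (forall x, map h (options1 x) =i options2 (h x)) ->
  forall n x, wins_within options2 n (h x) = wins_within options1 n x.
Proof.
move=> h_options; elim=> //= n IHn x.
rewrite -(eq_has_r (h_options x)) has_map.
by apply: eq_has => y /=; rewrite IHn.
Qed.

Section Strategy.

Variable G : sgraph.
Implicit Types (f : position G) (h : history G) (m : move G) (s : strategy G).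

Definition options f : seq (position G) := [seq do_move f m | m in legal f].

Definition uncolored f : nat := #|~: colored f|.

Lemma uncolored_do_move f m :
  legal f m -> (uncolored (do_move f m)).+1 = uncolored f.
Proof.
case/andP=> /eqP fm _; rewrite /uncolored [in RHS](cardsD1 m.1).
rewrite !inE fm eqxx add1n; congr _.+1; apply: eq_card => v.
by rewrite !inE ffunE; case: (v == m.1).
Qed.

Lemma uncolored_start : uncolored (start G) = #|G|.
Proof. by rewrite -cardsT; apply: eq_card => v; rewrite !inE ffunE. Qed.

Definition wins_from f : bool := winning options uncolored f.

Lemma wins_fromP f :
  reflect (exists2 m, legal f m & ~~ wins_from (do_move f m)) (wins_from f).
Proof.
rewrite /wins_from winningE => [|_ /imageP[m legal_m ->]]; last first.
  exact: uncolored_do_move.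
apply: (iffP hasP) => [[_ /imageP[m legal_m ->] ?]|[m legal_m ?]].
  by exists m.
by exists (do_move f m); first exact: image_f.
Qed.

Definition move_to_losing (m0 : move G) : strategy G := fun h =>
  odflt m0 [pick m | legal (position_after h) m &&
                     ~~ wins_from (do_move (position_after h) m)].

Lemma move_to_losingP m0 h (m := move_to_losing m0 h) :
  wins_from (position_after h) ->
  legal (position_after h) m /\ ~~ wins_from (do_move (position_after h) m).
Proof.
case/wins_fromP=> m1 legal_m1 losing_m1; rewrite /m /move_to_losing.
by case: pickP => [m' /andP[]|/(_ m1)] //=; rewrite legal_m1 losing_m1.
Qed.

Lemma position_after_rcons h m :
  position_after (rcons h m) = do_move (position_after h) m.
Proof. exact: foldl_rcons. Qed.

Lemma legal_history_rcons h m :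
  legal_history (rcons h m) -> legal_history h /\ legal (position_after h) m.
Proof.
exact: (@forall_prefix_rcons _ (fun h' => legal (position_after h'))).
Qed.

Lemma follows1_rcons s h m :
  follows1 s (rcons h m) -> follows1 s h /\ (~~ odd (size h) -> m = s h).
Proof.
exact: (@forall_prefix_rcons _ (fun h' m' => ~~ odd (size h') -> m' = s h')).
Qed.

Lemma wins_from_position_after m0 h :
  wins_from (start G) -> legal_history h -> follows1 (move_to_losing m0) h ->
  wins_from (position_after h) = ~~ odd (size h).
Proof.
move=> win0; elim/last_ind: h => [//|h m IHh].
case/legal_history_rcons=> legal_h legal_m /follows1_rcons[follows_h m_eq].
have := IHh legal_h follows_h; rewrite size_rcons position_after_rcons /=.
case: (odd (size h)) m_eq => [_|-> // win_h]; last first.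
  by apply/negbTE; have [] := move_to_losingP m0 win_h.
by apply: contraFT => losing_m; apply/wins_fromP; exists m.
Qed.

Lemma player1_wins_from_start :
  wins_from (start G) -> player1_has_winning_strategy G.
Proof.
move=> win0; have [m0 _ _] := wins_fromP _ win0.
exists (move_to_losing m0) => h legal_h follows_h.
have := wins_from_position_after win0 legal_h follows_h.
case: (odd _) => // /(move_to_losingP m0)[legal_m _].
by split=> // /(_ (move_to_losing m0 h)); rewrite legal_m.
Qed.

End Strategy.

(** * Edge colorings *)

Section InducedColoring.

Variables (G : sgraph) (C : finType).
Implicit Types (c : G -> C) (u v : G) (e : {set G}).

Lemma card_edge e : e \in edges G -> #|e| = 2.
Proof.
case/imsetP=> -[u v]; rewrite inE /= => uv ->; rewrite cards2.
by case: eqVneq uv => // ->; rewrite adj_irr.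
Qed.

Lemma induced_set2 c u v a :
  u != v -> induced c [set u; v] a = count_mem a [:: c u; c v].
Proof.
move=> uv; rewrite ffunE /= addn0 -sum1_card.
rewrite (eq_bigl (fun w => (w \in [set u; v]) && (c w == a))) => [|w].
  by rewrite big_mkcondr big_setU1 ?inE //= big_set1; do 2!case: (_ == a).
by rewrite !inE.
Qed.

Lemma induced_set2_eq c u v u' v' : u != v -> u' != v' ->
  (induced c [set u; v] == induced c [set u'; v']) =
  perm_eq [:: c u; c v] [:: c u'; c v'].
Proof.
move=> uv uv'; apply/eqP/idP => [eq_induced|/permP eq_count].
  by apply/allP => a _; apply/eqP; rewrite -!induced_set2 // eq_induced.
by apply/ffunP => a; rewrite !induced_set2.
Qed.

Lemma edge_distinguishing_Some k (c : {ffun G -> 'I_k}) :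
  edge_distinguishing c =
  partial_edge_distinguishing ([ffun v => Some (c v)] : pcoloring G k).
Proof.
set f : pcoloring G k := [ffun v => _].
have induced_f e :
    induced f e = [ffun x => if x is Some a then induced c e a else 0].
  apply/ffunP => -[a|]; rewrite !ffunE; last first.
    by apply: eq_card0 => v; rewrite !inE ffunE andbF.
  by apply: eq_card => v; rewrite !inE ffunE.
have mem_edges e : (e \in edges_in (colored f)) = (e \in edges G).
  rewrite inE andb_idr // => _; apply/subsetP => v _.
  by rewrite inE ffunE.
apply/dinjectiveP/dinjectiveP => inj e e'.
  rewrite !mem_edges !induced_f => Ge Ge' /ffunP eq_f; apply: inj => //.
  by apply/ffunP => a; have := eq_f (Some a); rewrite !ffunE.
rewrite -!mem_edges => fe fe' eq_c; apply: inj => //.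
by rewrite !induced_f eq_c.
Qed.

End InducedColoring.

(* A 2-multiset is determined by its support, so it suffices to count the sets
   of one or two colors. *)
Lemma card_edges_ed_colorable (G : sgraph) k :
  ed_colorable G k -> #|edges G| <= 'C(k.+1, 2).
Proof.
case/existsP=> c /dinjectiveP c_inj.
have edge_ends (e : {set G}) : e \in edges G ->
    exists u v, [/\ u != v, e = [set u; v] & c @: e = [set c u; c v]].
  move=> /card_edge/eqP/cards2P[u [v [uv ->]]].
  by exists u, v; rewrite imsetU1 imset_set1.
have support_inj : {in edges G &, injective (fun e : {set G} => c @: e)}.
  move=> e e' Ge Ge' /=; move: (c_inj e e' Ge Ge').
  have [u [v [uv -> ->]]] := edge_ends e Ge.
  have [u' [v' [uv' -> ->]]] := edge_ends e' Ge'.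
  by move=> inj_ee' /perm_eq_set2; rewrite -induced_set2_eq // => /eqP.
rewrite -(card_in_imset support_inj) binS.
rewrite -[k in 'C(k, 2)]card_ord -[k in 'C(k, 1)]card_ord.
rewrite -!card_draws; apply: leq_trans (leq_card_setU _ _).
apply/subset_leq_card/subsetP => _ /imsetP[e /edge_ends[u [v [_ _ ->]]] ->].
by rewrite !inE cards2; case: (_ != _).
Qed.

(** * Edges of paths *)

Section PathEdges.

Variable n : nat.
Implicit Types i j : 'I_n.

Definition edge_fst i : path_graph n.+1 := widen_ord (leqnSn n) i.
Definition edge_snd i : path_graph n.+1 := lift ord0 i.
Definition path_edge i : {set path_graph n.+1} := [set edge_fst i; edge_snd i].

Lemma edge_fst_neq_snd i : edge_fst i != edge_snd i.
Proof. by rewrite -val_eqE /= /bump /= add1n ltn_eqF. Qed.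

Lemma path_edge_inj : injective path_edge.
Proof.
move=> i j eq_ij; apply: val_inj.
have: edge_fst i \in path_edge j by rewrite -eq_ij set21.
have: edge_fst j \in path_edge i by rewrite eq_ij set21.
rewrite !inE -!val_eqE /= /bump /= !add1n => /orP[/eqP -> //|/eqP ->].
by rewrite ltn_eqF ?ltn_eqF.
Qed.

Lemma edges_path : edges (path_graph n.+1) = [set path_edge i | i : 'I_n].
Proof.
have edge_succ (u v : 'I_n.+1) : u.+1 = v -> exists i, [set u; v] = path_edge i.
  move=> uv; have un : u < n by rewrite -ltnS uv.
  by exists (Ordinal un); congr [set _; _]; apply: val_inj.
apply/setP => e; apply/imsetP/imsetP => [[[u v]]|[i _ ->]].
  rewrite inE => /orP[] /eqP /edge_succ[i eq_e] -> /=; exists i => //.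
  by rewrite setUC.
by exists (edge_fst i, edge_snd i); rewrite ?inE //= /path_adj /= eqxx.
Qed.

Lemma card_edges_path : #|edges (path_graph n.+1)| = n.
Proof. by rewrite edges_path card_imset ?card_ord //; apply: path_edge_inj. Qed.

Lemma perm_enum_edges_in (U : {set path_graph n.+1}) :
  perm_eq (enum (edges_in U))
          [seq path_edge i | i <- enum 'I_n & path_edge i \subset U].
Proof.
apply: uniq_perm => [||e]; first exact: enum_uniq.
  by rewrite (map_inj_uniq path_edge_inj) filter_uniq ?enum_uniq.
rewrite mem_enum inE edges_path; apply/andP/mapP => [[/imsetP[i _ ->] iU]|[i]].
  by exists i; rewrite // mem_filter iU mem_enum.
by rewrite mem_filter => /andP[iU _] ->; rewrite imset_f.
Qed.

End PathEdges.

(** * The game on a path as a game on lists *)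

(* A position on a path, listed along the path: 0 stands for an uncolored
   vertex and [a.+1] for the color [a]. *)
Definition board := seq nat.

Definition board_edges (b : board) : seq (seq nat) :=
  [seq [:: e.1; e.2] | e <- zip b (behead b)].

Definition board_ok (b : board) : bool :=
  uniq [seq sort leq e | e <- board_edges b & 0 \notin e].

Definition board_play (b : board) (m : nat * nat) : board :=
  set_nth 0 b m.1 m.2.

Definition board_moves (n k : nat) : seq (nat * nat) :=
  [seq (v, a) | v <- iota 0 n, a <- iota 1 k].

Definition board_legal (b : board) (m : nat * nat) : bool :=
  (nth 0 b m.1 == 0) && board_ok (board_play b m).

Definition board_options (n k : nat) (b : board) : seq board :=
  [seq board_play b m | m <- board_moves n k & board_legal b m].

Definition color_code (k : nat) (x : option 'I_k) : nat :=
  if x is Some a then a.+1 else 0.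

Lemma color_code_inj k : injective (@color_code k).
Proof. by move=> [a|] [b|] //= [/val_inj ->]. Qed.

Definition board_of (n k : nat) (f : pcoloring (path_graph n) k) : board :=
  [seq color_code (f v) | v <- enum 'I_n].

Section PartialColoringBoard.

Variables n k : nat.
Implicit Types (f : pcoloring (path_graph n.+1) k).

Lemma size_board_of f : size (board_of f) = n.+1.
Proof. by rewrite size_map size_enum_ord. Qed.

Lemma nth_board_of f (v : 'I_n.+1) : nth 0 (board_of f) v = color_code (f v).
Proof. by rewrite (nth_map v) ?size_enum_ord // nth_ord_enum. Qed.

Lemma board_edges_of f :
  board_edges (board_of f) =
  [seq map (@color_code k) [:: f (edge_fst i); f (edge_snd i)]
     | i <- enum 'I_n].
Proof.
rewrite /board_edges /board_of [in behead _]enum_ordSl enum_ordSr /=.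
rewrite map_rcons -cats1 -[map _ [seq lift _ _ | _ <- _]]cats0.
by rewrite zip_cat ?size_map // cats0 -!map_comp zip_map -map_comp.
Qed.

Lemma path_edge_sub_colored f (i : 'I_n) :
  (path_edge i \subset colored f) =
  (0 \notin map (@color_code k) [:: f (edge_fst i); f (edge_snd i)]).
Proof.
by rewrite subUset !sub1set !inE; case: (f _) => //= ?; case: (f _).
Qed.

Lemma partial_edge_distinguishing_board f :
  partial_edge_distinguishing f = board_ok (board_of f).
Proof.
rewrite /partial_edge_distinguishing /dinjectiveb /board_ok board_edges_of.
rewrite (perm_uniq (perm_map _ (perm_enum_edges_in _))).
rewrite (eq_filter (path_edge_sub_colored f)) [in RHS](filter_map _).
rewrite -(map_comp (induced f)) -(map_comp (sort leq)).
apply: eq_uniq_map => i j; rewrite [LHS]induced_set2_eq ?edge_fst_neq_snd //.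
apply: perm_eq_sort_map; last exact: color_code_inj.
- exact: leq_total.
- exact: leq_trans.
- exact: anti_leq.
Qed.

End PartialColoringBoard.

Section BoardGame.

Variable n : nat.
Let G := path_graph n.+1.
Implicit Types (f : position G) (m : move G).

Definition move_code m : nat * nat := (val m.1, (val m.2).+1).

Lemma board_of_do_move f m :
  board_of (do_move f m) = board_play (board_of f) (move_code m).
Proof.
apply: (@eq_from_nth _ 0) => [|i]; rewrite size_board_of.
  by rewrite size_set_nth size_board_of (maxn_idPr (ltn_ord m.1)).
move=> lt_i_n; rewrite nth_set_nth /= -[i]/(val (Ordinal lt_i_n)).
by rewrite !nth_board_of ffunE -val_eqE /=; case: (i == _).
Qed.

Lemma legal_board f m : legal f m = board_legal (board_of f) (move_code m).
Proof.
rewrite /legal /board_legal partial_edge_distinguishing_board board_of_do_move.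
by rewrite nth_board_of; case: (f _).
Qed.

Lemma mem_board_moves (p : nat * nat) :
  (p \in board_moves n.+1 (lambda G)) = (p \in codom move_code).
Proof.
apply/allpairsP/codomP => [[[v a] []]|[[v a] ->]]; last first.
  by exists (val v, (val a).+1); rewrite !mem_iota add1n ltnS !ltn_ord.
rewrite !mem_iota /= => lt_v /andP[a_gt0 lt_a] ->.
case: a a_gt0 lt_a => // a _ lt_a.
by exists (Ordinal (lt_v : v < n.+1), Ordinal (lt_a : a < lambda G)).
Qed.

Lemma board_of_options f :
  [seq board_of g | g <- options f] =i
  board_options n.+1 (lambda G) (board_of f).
Proof.
move=> b; apply/mapP/mapP => [[_ /imageP[m legal_m ->] ->]|[m]].
  exists (move_code m); last exact: board_of_do_move.
  by rewrite mem_filter mem_board_moves codom_f -legal_board andbT.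
rewrite mem_filter mem_board_moves => /andP[/[swap] /codomP[m' ->]].
rewrite -legal_board => legal_m' ->.
by exists (do_move f m'); [exact: image_f | rewrite board_of_do_move].
Qed.

Lemma board_of_start : board_of (start G) = nseq n.+1 0.
Proof.
apply: (@eq_from_nth _ 0) => [|i]; rewrite size_board_of ?size_nseq // => lt_i.
by rewrite -[i]/(val (Ordinal lt_i)) nth_board_of ffunE nth_nseq if_same.
Qed.

Lemma wins_from_start_board :
  wins_from (start G) =
  wins_within (board_options n.+1 (lambda G)) n.+1 (nseq n.+1 0).
Proof.
rewrite -board_of_start (wins_within_morph board_of_options).
by rewrite /wins_from /winning uncolored_start card_ord.
Qed.

End BoardGame.

(** * The path on six vertices *)

Lemma ed_colorable_P6 : ed_colorable (path_graph 6) 3.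
Proof.
apply/existsP; exists [ffun v : 'I_6 => inord v./2].
rewrite edge_distinguishing_Some partial_edge_distinguishing_board.
by rewrite /board_of !enum_ordSl enum_ord0 /= !ffunE /= !inordK.
Qed.

Lemma lambda_P6 : lambda (path_graph 6) = 3.
Proof.
rewrite /lambda; case: ex_minnP => k colorable_k min_k; apply/eqP.
rewrite eqn_leq min_k ?ed_colorable_P6 //= ltnNge; apply/negP => le_k_2.
have := card_edges_ed_colorable colorable_k; rewrite card_edges_path.
by move/leq_trans/(_ (leq_bin2l 2 (le_k_2 : k.+1 <= 3))).
Qed.

(* Lazy evaluation cuts [has] off at the first option that settles it; call by
   value would visit the whole game tree. *)
Lemma second_vertex_opening_wins_P6 :
  ~~ wins_within (board_options 6 3) 5 [:: 0; 1; 0; 0; 0; 0].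
Proof. by lazy. Qed.

Theorem theorem3p11 : player1_has_winning_strategy (path_graph 6).
Proof.
apply: player1_wins_from_start; rewrite wins_from_start_board lambda_P6.
apply/hasP; exists [:: 0; 1; 0; 0; 0; 0]; first by [].
exact: second_vertex_opening_wins_P6.
Qed.
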